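(* Let $n,c,s,k$ be integers with $n\geq c\geq 5$, $s\geq 2$ and $k\geq 2$. If $G$ is a 2-connected graph on $n$ vertices with circumference less than $c$ and minimum degree $\delta(G)\geq k$, then $$N_s(G)\leq \max\left\{f_s(n,k,c),\ f_s\left(n,\left\lfloor\tfrac{c-1}{2}\right\rfloor,c\right)\right\}.$$
   Context: Graphs are finite and simple. $N_s(G)$ denotes the number of copies of $K_s$ in $G$, i.e. the number of $s$-element vertex subsets of $G$ inducing a complete graph. The circumference of a graph is the length (number of edges) of a longest cycle in it. The function $f_s$ is defined by $$f_s(n,k,c)=\binom{c-k}{s}+\binom{k}{s-1}\bigl(n-(c-k)\bigr).$$ It is the number of copies of $K_s$ in the graph $H(n,k,c)$ obtained from $K_{c-k}$ by adding a set of $n-(c-k)$ pairwise nonadjacent new vertices and joining each of them to the same $k$ vertices chosen from $K_{c-k}$. *)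

(* Defs.v *)
From mathcomp Require Import all_boot.

Set Implicit Arguments.
Unset Strict Implicit.
Unset Printing Implicit Defensive.

(* Finite simple graphs: a symmetric irreflexive adjacency relation on a
   finite type of vertices. *)
Definition simple_graph (T : finType) (e : rel T) : Prop :=
  symmetric e /\ irreflexive e.

Definition degree (T : finType) (e : rel T) (x : T) : nat :=
  #|[set y | e x y]|.

(* The default value #|T| exceeds every degree of a simple graph, so it plays
   no role as soon as there is a vertex. *)
Definition min_degree (T : finType) (e : rel T) : nat :=
  \big[minn/#|T|]_(x : T) degree e x.

(* Connectedness of the subgraph induced on A. *)
Definition connected_on (T : finType) (e : rel T) (A : {set T}) : bool :=
  [forall x in A, forall y in A,
    connect [rel u v | [&& u \in A, v \in A & e u v]] x y].

Definition vertex_connected (T : finType) (e : rel T) (m : nat) : bool :=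
  (m < #|T|) && [forall X : {set T}, (#|X| < m) ==> connected_on e (~: X)].

(* The bound 2 < m is needed because [ucycle] also accepts the empty sequence
   and a single edge traversed back and forth. *)
Definition has_cycle (T : finType) (e : rel T) (m : nat) : bool :=
  (2 < m) && [exists p : m.-tuple T, ucycleb e p].

(* A cycle has at most #|T| vertices; the value is 0 for an acyclic graph. *)
Definition circumference (T : finType) (e : rel T) : nat :=
  \max_(m < #|T|.+1 | has_cycle e m) m.

Definition is_clique (T : finType) (e : rel T) (A : {set T}) : bool :=
  [forall x in A, forall y in A, (x != y) ==> e x y].

Definition num_cliques (T : finType) (e : rel T) (s : nat) : nat :=
  #|[set A : {set T} | (#|A| == s) && is_clique e A]|.

(* Subtractions are truncated; they are exact when k <= c <= n + k. *)
Definition f_s (s n k c : nat) : nat :=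
  'C(c - k, s) + 'C(k, s.-1) * (n - (c - k)).

(* Main.v *)
Require Import Defs.
From mathcomp Require Import all_boot zify.

Set Implicit Arguments.
Unset Strict Implicit.
Unset Printing Implicit Defensive.

(** Kopylov's method for cliques in 2-connected graphs without long cycles.

    Adding edges while the circumference stays below [c] only increases the
    number of cliques, so every two nonadjacent vertices may be assumed to be
    joined by a path with at least [c] vertices ([clique_bound]).

    The engine is Kopylov's lemma ([kopylov_long_cycle]): in a 2-connected
    graph, a path with at least [c] vertices whose two ends have together at
    least [c] neighbours on the path forces a cycle of length at least [c].
    Applied to a longest path between nonadjacent vertices of [U] and [H] it
    shows that [U] and [H] are completely joined as soon as the minimum degrees
    of the induced subgraphs on [U] and [H] add up to at least [c]
    ([saturated_adjacent]).

    Put [t := (c - 1) / 2] and let [H] be the [(t + 1)]-core, of order [r].  If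
    [H] is empty, deleting vertices of degree at most [t] one after the other
    and stopping at [c - t] vertices gives the bound [f_s s n t c]
    ([num_cliques_in_core]).  Otherwise [saturated_adjacent] is used three
    times: with [U = H] it shows that [H] is a clique; with [U] the whole graph
    it shows that [k <= c - r]; with [U] the [(c - r + 1)]-core it shows that
    this core is contained in [H].  Hence the graph is obtained from [H] by
    adding vertices of degree at most [c - r], which gives the bound
    [f_s s n (c - r) c] with [k <= c - r <= t]; as [f_s] is convex in that
    argument ([f_s_convex]), it is at most the larger of its values at [k] and
    at [t].

    In Kopylov's lemma, let [x] and [y] be the ends of the path.  If a
    neighbour of [y] precedes a neighbour of [x], either two such neighbours
    are consecutive and all vertices of the path lie on a cycle, or a closest
    such pair yields a cycle that counting shows to be long enough
    ([crossing_long_cycle]).  If all neighbours of [x] come before those of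
    [y], 2-connectedness provides two disjoint paths from the part next to [x]
    to the part next to [y] ([linkage_along]), and these close up to a cycle
    through [x] and all neighbours of [x] and [y] on the path
    ([cycle_through_uncrossed]). *)

(** * Convexity of the bound *)

(** With [M = c - i - 2], Pascal's rule turns the second difference of the first
    summand into ['C(M.+1, s.-1) - 'C(M, s.-1)], which is nonnegative; the other
    summand is a product of two nonnegative, nondecreasing and convex functions
    of [i]. *)
Lemma f_s_convex s n c i : 0 < s.-1 -> c <= n -> i.+2 <= c ->
  (f_s s n i.+1 c).*2 <= f_s s n i c + f_s s n i.+2 c.
Proof.
case: s => [|[|p]] // _ c_n i_c; rewrite /f_s /=.
have [M cE] : exists M, c = M + i.+2 by exists (c - i.+2); lia.
have [N nE] : exists N, n = c + N by exists (n - c); lia.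
have -> : c - i = M.+2 by lia.
have -> : c - i.+1 = M.+1 by lia.
have -> : c - i.+2 = M by lia.
have -> : n - M.+2 = N + i by lia.
have -> : n - M.+1 = (N + i).+1 by lia.
have -> : n - M = (N + i).+2 by lia.
move: (N + i) => D.
have leM : 'C(M, p.+1) <= 'C(M.+1, p.+1) by apply: leq_bin2l.
have leI : 'C(i, p) <= 'C(i.+1, p) by apply: leq_bin2l.
rewrite (binS M.+1) (binS i.+1) (binS i) (binS M p.+1) in leM *.
move: ('C(i, p)) ('C(i, p.+1)) ('C(i.+1, p)) leI => b a g leI.
move: leM; rewrite (binS M p).
move: ('C(M, p.+2)) ('C(M, p.+1)) ('C(M, p)) => u v w _.
nia.
Qed.

(** If the first step of [f] is a descent, the left end point can be moved to
    the right; otherwise convexity makes [f] nondecreasing up to [t]. *)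
Lemma convex_le_max (f : nat -> nat) k t :
  (forall i, k <= i -> i.+2 <= t -> (f i.+1).*2 <= f i + f i.+2) ->
  forall j, k <= j <= t -> f j <= maxn (f k) (f t).
Proof.
have [d] := ubnP (t - k); elim: d k => // d IHd k td cvx j /andP[kj jt].
have [<-|kltj] := eqVneq k j; first exact: leq_maxl.
have k_lt_t : k < t by lia.
have [le1|lt1] := leqP (f k.+1) (f k).
  have /= := IHd k.+1 _ _ j _; move=> /(_ _ _ _)-H.
  apply: leq_trans (H _ _ _) _; try lia.
  by move=> i ki; apply: cvx; lia.
have incr i : k + i < t -> f (k + i) <= f (k + i).+1.
  elim: i => [|i IHi] it; first by rewrite addn0 ltnW.
  have := cvx (k + i); rewrite addnS => /(_ _ _) H; have := IHi _; lia.
have {incr} H i : j + i <= t -> f j <= f (j + i).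
  elim: i => [|i IHi] it; first by rewrite addn0.
  have := incr (j + i - k); have -> : k + (j + i - k) = j + i by lia.
  by rewrite addnS; have := IHi; lia.
have := H (t - j); rewrite subnKC // => /(_ _) H'; rewrite leq_max H' ?orbT //.
Qed.

(** * Counting cliques by peeling off vertices *)

Section Cliques.
Variables (T : finType) (e : rel T).

Definition degree_in (S : {set T}) (x : T) : nat := #|[set y in S | e x y]|.

Definition num_cliques_in (S : {set T}) (s : nat) : nat :=
  #|[set A : {set T} | [&& A \subset S, #|A| == s & is_clique e A]]|.

(** The [(t + 1)]-core.  Inducing minimum degree greater than [t] is stable
    under unions, so this union is the largest such set, the one that remains when
    vertices of degree at most [t] are deleted as long as there are any. *)
Definition core (t : nat) : {set T} :=
  \bigcup_(S : {set T} | [forall x in S, t < degree_in S x]) S.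

Lemma degree_in_subset (S S' : {set T}) x :
  S \subset S' -> degree_in S x <= degree_in S' x.
Proof.
move=> /subsetP sSS'; apply/subset_leq_card/subsetP => y.
by rewrite !inE => /andP[/sSS' -> ->].
Qed.

Lemma sub_core t (S : {set T}) :
  (forall x, x \in S -> t < degree_in S x) -> S \subset core t.
Proof. by move=> dS; apply: bigcup_sup; apply/forall_inP. Qed.

Lemma core_degree t x : x \in core t -> t < degree_in (core t) x.
Proof.
case/bigcupP => S /forall_inP dS xS; apply: leq_trans (dS x xS) _.
by apply/degree_in_subset/sub_core.
Qed.

Lemma num_cliques_in_le_bin (S : {set T}) s :
  num_cliques_in S s <= 'C(#|S|, s).
Proof.
rewrite -cards_draws; apply/subset_leq_card/subsetP => A.
by rewrite !inE => /and3P[-> ->].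
Qed.

(** A clique of order [s] through [x] is determined by its [s - 1] other
    vertices, which are neighbours of [x] in [S]. *)
Lemma num_cliques_in_remove (S : {set T}) x s : x \in S -> 0 < s ->
  num_cliques_in S s
    <= num_cliques_in (S :\ x) s + 'C(degree_in S x, s.-1).
Proof.
move=> xS s_gt0.
pose C := [set A : {set T} | [&& A \subset S, #|A| == s & is_clique e A]].
rewrite -[num_cliques_in S s]/#|C| -(cardsID [set A : {set T} | x \notin A] C).
apply: leq_add.
  apply/subset_leq_card/subsetP => A; rewrite !inE.
  by case/andP=> /and3P[AS -> ->] xA; rewrite subsetD1 AS xA.
rewrite -cards_draws; set D := _ :\: _.
have injD : {in D &, injective (fun A : {set T} => A :\ x)}.
  move=> A B; rewrite !inE !negbK => /andP[xA _] /andP[xB _] eqAB.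
  by rewrite -(setD1K xA) -(setD1K xB) eqAB.
rewrite -(card_in_imset injD).
apply/subset_leq_card/subsetP => _ /imsetP[A AD ->].
move: AD; rewrite !inE negbK => /andP[xA /and3P[/subsetP AS /eqP cA clA]].
rewrite -cA (cardsD1 x A) xA /= eqxx andbT.
apply/subsetP => y; rewrite !inE => /andP[yx yA]; rewrite AS //=.
by move/forall_inP/(_ x xA)/forall_inP/(_ y yA): clA; rewrite eq_sym yx.
Qed.

(** A set strictly larger than the core has a vertex with at most [t] neighbours
    in it; such a vertex lies outside the core and can be deleted.  The deletion
    may stop at any order [w] not below that of the core, where all [s]-subsets
    are counted: stopping at [#|core t|] is sharp when the core is a clique,
    and a larger [w] serves when the core is empty. *)
Lemma num_cliques_in_core t s w (S : {set T}) :
  0 < s -> core t \subset S -> #|core t| <= w ->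
  num_cliques_in S s <= 'C(w, s) + 'C(t, s.-1) * (#|S| - w).
Proof.
move=> s_gt0 + cw; have [m] := ubnP #|S|; elim: m S => // m IHm S Sm cS.
have [Sw|wS] := leqP #|S| w.
  apply: leq_trans (num_cliques_in_le_bin S s) _.
  by apply: leq_trans (leq_bin2l _ Sw) (leq_addr _ _).
have : ~~ [forall x in S, t < degree_in S x].
  apply/negP => /forall_inP /sub_core /subset_leq_card Sc; lia.
case/forall_inPn => x xS; rewrite -leqNgt => dx.
have xNc : x \notin core t.
  apply/negP => /core_degree; have := degree_in_subset x cS; lia.
have := num_cliques_in_remove xS s_gt0.
have := cardsD1 x S; rewrite xS => cardS.
have := IHm (S :\ x) _ _; rewrite subsetD1 cS xNc => /(_ _ isT) IH.
have := leq_bin2l s.-1 dx.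
have -> : #|S| - w = (#|S :\ x| - w).+1 by lia.
rewrite mulnS; have := IH _; lia.
Qed.

Lemma num_cliquesE s : num_cliques e s = num_cliques_in [set: T] s.
Proof.
rewrite /num_cliques /num_cliques_in.
by congr #|pred_of_set _|; apply/setP => A; rewrite !inE subsetT.
Qed.

End Cliques.

Lemma num_cliques_homo (T : finType) (e e' : rel T) s :
  (forall x y, e x y -> e' x y) -> num_cliques e s <= num_cliques e' s.
Proof.
move=> ee'; apply/subset_leq_card/subsetP => A; rewrite !inE.
case/andP=> -> clA; apply/forall_inP => x xA; apply/forall_inP => y yA.
move/forall_inP/(_ x xA)/forall_inP/(_ y yA)/implyP: clA => exy.
by apply/implyP => /exy /ee'.
Qed.

(** * Simple paths *)

Section Paths.
Variables (T : finType) (e : rel T).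
Hypothesis e_sym : symmetric e.

Definition upath (u v : T) (s : seq T) : bool :=
  [&& path e u s, last u s == v & uniq (u :: s)].

Lemma uniq_cat_disjoint (s1 s2 : seq T) :
  uniq s1 -> uniq s2 -> (forall t, t \in s1 -> t \in s2 -> False) ->
  uniq (s1 ++ s2).
Proof.
move=> u1 u2 dis; rewrite cat_uniq u1 u2 andbT /=.
by apply/hasPn => t t2; apply/negP => t1; apply: dis t1 t2.
Qed.

Lemma path_rev u s : path e u s -> path e (last u s) (rev (belast u s)).
Proof. by rewrite rev_path; apply: sub_path => a b; rewrite e_sym. Qed.

Lemma uniq_rev_cat (s1 s2 : seq T) : uniq (rev s1 ++ s2) = uniq (s1 ++ s2).
Proof.
rewrite !cat_uniq rev_uniq; congr [&& _, ~~ _ & _].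
by apply: eq_has => t; rewrite /= mem_rev.
Qed.

Lemma upath_rev u v s : upath u v s ->
  exists2 s', upath v u s' & v :: s' =i u :: s.
Proof.
case/and3P=> ps /eqP <- us; exists (rev (belast u s)); last first.
  by move=> t; rewrite -rev_rcons -lastI mem_rev.
rewrite /upath path_rev // -rev_rcons -lastI rev_uniq us andbT /=.
by case: s {ps us} => //= a s; rewrite rev_cons last_rcons.
Qed.

(** On a path from [x] to a neighbour [z] of [x], go from [u] back to [x], jump
    to the first neighbour of [x] after [u], and continue to [z]: only vertices
    strictly between [u] and that neighbour are left out. *)
Lemma upath_reroute x z p u : upath x z p -> e x z -> u \in belast x p ->
  exists s, [/\ upath u z s, {subset u :: s <= x :: p}, x \in u :: s &
                {in p, forall w, e x w -> w \in u :: s}].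
Proof.
case/and3P=> pp /eqP lp up exz uB.
have [p1 [p2 [Ep p2n]]] : exists p1 p2, x :: p = p1 ++ u :: p2 /\ p2 != [::].
  rewrite lastI lp; case/splitPr: uB => p1 p2; exists p1, (rcons p2 z).
  by rewrite rcons_cat; split => //; case: p2.
have zp2 : z \in p2.
  rewrite -lp -[last x p]/(last x (x :: p)) Ep last_cat.
  by case: p2 p2n {Ep} => //= a p2 _; apply: mem_last.
have hp2 : has (e x) p2 by apply/hasP; exists z.
case/split_find: hp2 Ep zp2 => w p3 p4 exw nh3 Ep zp2.
have memp t : t \in x :: p = (t \in p1 ++ u :: rcons p3 w ++ p4) by rewrite Ep.
exists (rev p1 ++ w :: p4).
have Erev : u :: rev p1 ++ w :: p4 = rev (rcons p1 u) ++ w :: p4.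
  by rewrite rev_rcons.
have xp1 : (path e u (rev p1)) && (last u (rev p1) == x).
  case: p1 Ep {memp Erev} => [[-> _]|a p1 [<- Ep]] //=.
  move: pp; rewrite Ep -cat_rcons cat_path => /andP[/path_rev].
  by rewrite last_rcons belast_rcons => -> _; rewrite rev_cons last_rcons eqxx.
have [pu /eqP lu] := andP xp1.
split.
- have lw : last w p4 = z.
    rewrite -lp -[last x p]/(last x (x :: p)) Ep last_cat /=.
    by rewrite last_cat last_rcons.
  apply/and3P; split.
  + rewrite cat_path pu lu /= exw /=.
    case: p1 Ep {memp Erev xp1 pu lu} => [[_ Ep]|a p1 [_ Ep]];
      move: pp; rewrite Ep.
      by rewrite cat_path last_rcons => /andP[].
    by rewrite cat_path /= cat_path last_rcons => /and4P[].
  + by rewrite last_cat /= lw.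
  + rewrite Erev uniq_rev_cat; apply: subseq_uniq up.
    rewrite Ep -(cat_rcons u p1); apply: cat_subseq => //.
    rewrite cat_rcons; exact: suffix_subseq.
- move=> t; rewrite memp Erev !mem_cat mem_rev mem_rcons !inE mem_cat.
  rewrite mem_rcons !inE.
  by do ![case/orP] => ->; rewrite ?orbT.
- by rewrite -cat_cons mem_cat -lu mem_last.
- move=> t tp ext; have := memp t; rewrite inE tp orbT Erev !mem_cat mem_rev.
  rewrite mem_rcons !inE mem_cat mem_rcons !inE => /esym.
  case/or4P=> [->|->||->]; rewrite ?orbT //.
  case/orP=> [->|t3]; rewrite ?orbT //.
  by case/hasP: nh3; exists t.
Qed.

Lemma upath_reroute_rev x z p u : upath x z p -> e x z -> u \in belast x p ->
  exists s, [/\ upath z u s, {subset z :: s <= x :: p}, x \in z :: s &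
                {in p, forall w, e x w -> w \in z :: s}].
Proof.
move=> up exz uB; have [s [us sub xs cov]] := upath_reroute up exz uB.
have [s' us' ss'] := upath_rev us.
exists s'; split=> // [t||w wp exw]; rewrite ss' //; first exact: sub.
exact: cov.
Qed.

Lemma split_last (a : pred T) s : has a s ->
  exists s1 z s2, [/\ s = s1 ++ z :: s2, a z & ~~ has a s2].
Proof.
rewrite -has_rev -{2}(revK s) => /split_find[z s1 s2 az ns].
by exists (rev s2), z, (rev s1); rewrite rev_cat rev_rcons has_rev.
Qed.

Lemma not_path (r : rel T) h s : ~~ path r h s ->
  exists s1 u w s2, h :: s = s1 ++ u :: w :: s2 /\ ~~ r u w.
Proof.
elim: s h => //= w s IHs h; rewrite negb_and; have [rhw|nr _] := boolP (r h w).
  move=> /IHs[s1 [u [v [s2 [-> nr]]]]]; by exists (h :: s1), u, v, s2.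
by exists [::], h, w, s.
Qed.

End Paths.

(** * Two disjoint paths along a given path *)

Section Linkage.
Variables (T : finType) (e : rel T).

(** No vertex [u] separates the graph: a nonempty set [D] that does not contain
    [u] and is not the whole of the other vertices has an edge leaving it that
    avoids [u].  Unlike [vertex_connected] this is visibly preserved when edges
    are added, and it is the form in which sets are grown below. *)
Definition no_cut_vertex : Prop := forall (D : {set T}) u d0 w0,
  d0 \in D -> u \notin D -> w0 \notin D -> w0 != u ->
  exists d w, [/\ d \in D, w \notin D, w != u & e d w].

(** A substitute for a path out of [X]: two disjoint sets of this kind can be
    grown vertex by vertex, and a path, which meets [X] only at its start, is
    extracted from each at the end. *)
Definition rooted (X C : {set T}) : Prop :=
  X \subset C /\ forall v, v \in C ->
    exists u p, [/\ u \in X, upath e u v p & {subset p <= C :\: X}].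

Definition rooted_pair (X Y F C C' : {set T}) : Prop :=
  [/\ rooted X C, rooted Y C', [disjoint C & C'] & [disjoint C :|: C' & F]].

(** Two disjoint connections, from [X] to [v] and from [Y] into [Z].  [Z] stands
    for the rest of a path beyond [v], which the second connection touches only
    with its last vertex [w]; thus the first one can still follow that path. *)
Definition linked (X Y : {set T}) (v : T) (Z : {set T}) : Prop :=
  exists C C', [/\ rooted_pair X Y Z C C', v \in C &
    exists d w, [/\ d \in C', w \in Z & e d w]].

Lemma rooted_pair_sym X Y F C C' :
  rooted_pair X Y F C C' -> rooted_pair Y X F C' C.
Proof.
by case=> *; split=> //; [rewrite disjoint_sym | rewrite setUC].
Qed.

Lemma rooted_refl (X : {set T}) : rooted X X.
Proof.
split=> // v vX; exists v, [::]; split=> //.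
by rewrite /upath /= eqxx.
Qed.

Lemma rooted_add (X C : {set T}) d w :
  rooted X C -> d \in C -> w \notin C -> e d w ->
  rooted X (w |: C).
Proof.
case=> /subsetP XC rC dC wC edw; split.
  by apply/subsetP => t /XC; rewrite !inE orbC => ->.
have wX : w \notin X by apply: contra wC; apply: XC.
move=> v; rewrite !inE => /orP[/eqP->|/rC[u [p [uX up pC]]]]; last first.
  exists u, p; split => // t /pC; rewrite !inE => /andP[-> ->].
  by rewrite orbT.
have [u [p [uX /and3P[pp /eqP lp upp] pC]]] := rC d dC.
exists u, (rcons p w); split => //.
  rewrite /upath rcons_path pp lp edw last_rcons eqxx.
  rewrite -rcons_cons rcons_uniq upp /=.
  rewrite inE negb_or andbT; apply/andP; split.
    by apply: contraNneq wX => ->.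
  by apply: contra wC => /pC; rewrite inE => /andP[].
move=> t; rewrite mem_rcons !inE => /orP[/eqP->|/pC].
  by rewrite eqxx wX.
by rewrite !inE => /andP[-> ->]; rewrite orbT.
Qed.

Lemma rooted_pair_add X Y F C C' d w :
  rooted_pair X Y F C C' -> d \in C -> w \notin C :|: C' -> w \notin F ->
  e d w -> rooted_pair X Y F (w |: C) C'.
Proof.
rewrite inE negb_or => -[rC rC' dis disF] dC /andP[wC wC'] wF edw; split => //.
- exact: rooted_add edw.
- by rewrite -setI_eq0 setIUl setU_eq0 !setI_eq0 disjoints1 wC'.
- by rewrite -setUA -setI_eq0 setIUl setU_eq0 !setI_eq0 disjoints1 wF.
Qed.

(** As [u] is not a cut vertex, there is an edge that leaves the union of the
    two sets and avoids [u].  Either it ends in [Z], or its end can be added to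
    the set from which it comes. *)
Lemma rooted_pair_grow (nc : no_cut_vertex) X Y u Z C C' d0 w0 :
  rooted_pair X Y (u |: Z) C C' -> d0 \in C :|: C' -> w0 \in Z -> w0 != u ->
  exists C1 C1' : {set T}, [/\ C \subset C1, C' \subset C1',
    rooted_pair X Y (u |: Z) C1 C1' &
    exists d w, [/\ d \in C1 :|: C1', w \in Z & e d w]].
Proof.
have [m] := ubnP #|~: (C :|: C')|.
elim: m C C' => // m IHm C C' Sm rp d0D w0Z w0u.
have [rC rC' dis disF] := rp.
have disF' t : t \in u |: Z -> t \notin C :|: C'.
  by move=> tF; rewrite (disjointFl disF).
have uD : u \notin C :|: C' by apply: disF'; rewrite !inE eqxx.
have w0D : w0 \notin C :|: C' by apply: disF'; rewrite !inE w0Z orbT.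
have [d [w [dD wD wu edw]]] := nc _ _ _ _ d0D uD w0D w0u.
have [wZ|wZ] := boolP (w \in Z).
  by exists C, C'; split=> //; exists d, w.
have wF : w \notin u |: Z by rewrite !inE negb_or wu.
have grown (C2 C2' : {set T}) : C2 :|: C2' = w |: (C :|: C') ->
    #|~: (C2 :|: C2')| < m.
  move=> ->; rewrite setCU setIC -setDE.
  by move: (cardsD1 w (~: (C :|: C'))); rewrite [w \in _]inE wD; lia.
move: (dD); rewrite inE => /orP[dC|dC'].
  have [] := IHm (w |: C) C' _ (rooted_pair_add rp dC wD wF edw) _ w0Z w0u.
  - by apply: grown; rewrite setUA.
  - by rewrite -setUA inE d0D orbT.
  move=> C1 [C1' [s1 s2 rp1 cr]]; exists C1, C1'; split => //.
  exact: subset_trans (subsetUr _ _) s1.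
have rp' := rooted_pair_sym rp; rewrite setUC in wD.
have rp2 := rooted_pair_sym (rooted_pair_add rp' dC' wD wF edw).
have [] := IHm C (w |: C') _ rp2 _ w0Z w0u.
- by apply: grown; rewrite setUCA.
- by rewrite setUCA inE d0D orbT.
move=> C1 [C1' [s1 s2 rp1 cr]]; exists C1, C1'; split => //.
exact: subset_trans (subsetUr _ _) s2.
Qed.

Lemma rooted_pair_sub X Y (F F' C C' : {set T}) : F' \subset F ->
  rooted_pair X Y F C C' -> rooted_pair X Y F' C C'.
Proof. by move=> sF [? ? ? disF]; split => //; apply: disjointWr sF disF. Qed.

Lemma linked_extend X Y u v Z C C' d w :
  rooted_pair X Y (u |: Z) C C' -> v \in C -> e v u -> u \notin Z ->
  d \in C' -> w \in Z -> e d w -> linked X Y u Z.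
Proof.
move=> rp vC evu uZ dC' wZ edw; exists (u |: C), C'; split.
- have [_ _ _ disF] := rp.
  apply: rooted_pair_add evu => //.
    exact: rooted_pair_sub (subsetUr _ _) rp.
  by rewrite (disjointFl disF) // !inE eqxx.
- by rewrite !inE eqxx.
- by exists d, w.
Qed.

(** The frontier advances from [v] to the next vertex [u].  If the second
    connection can already reach [Z] beyond [u], the first one is extended to
    [u].  Otherwise both sets are adjacent to [u]; growing them while avoiding
    [u] lets one of them reach [Z], and the other one takes [u].  This is where
    the roles of [X] and [Y] may be exchanged. *)
Lemma linked_step (nc : no_cut_vertex) X Y v u Z w0 :
  linked X Y v (u |: Z) -> e v u -> u \notin Z -> w0 \in Z ->
  linked X Y u Z \/ linked Y X u Z.
Proof.
case=> C [C' [rp vC [d [w [dC' wF edw]]]]] evu uZ w0Z.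
move: wF; rewrite !inE => /orP[/eqP wE|wZ]; last first.
  by left; exact: linked_extend rp vC evu uZ dC' wZ edw.
rewrite {w}wE in edw.
have w0u : w0 != u by apply: contraNneq uZ => <-.
have vD : v \in C :|: C' by rewrite inE vC.
have [C1 [C1' [/subsetP sC /subsetP sC' rp1 [d1 [w1 [d1D w1Z e1]]]]]] :=
  rooted_pair_grow nc rp vD w0Z w0u.
move: d1D; rewrite inE => /orP[d1C|d1C'].
  right.
  exact: linked_extend (rooted_pair_sym rp1) (sC' _ dC') edw uZ d1C w1Z e1.
by left; apply: linked_extend rp1 (sC _ vC) evu uZ d1C' w1Z e1.
Qed.

Lemma linked_walk (nc : no_cut_vertex) X Y v q1 q2 :
  path e v q1 -> uniq (v :: q1 ++ q2) -> q2 != [::] ->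
  linked X Y v [set t in q1 ++ q2] ->
  linked X Y (last v q1) [set t in q2] \/
  linked Y X (last v q1) [set t in q2].
Proof.
move=> + + q2n; elim: q1 v X Y => [|u q1 IHq] v X Y /=; first by left.
case/andP=> evu pu /andP[_ uq]; rewrite set_cons => lk.
have [w0 w0q] : exists w0, w0 \in q1 ++ q2.
  case: q2 q2n {IHq uq lk} => // w0 q2 _; exists w0.
  by rewrite mem_cat inE eqxx orbT.
have uZ : u \notin [set t in q1 ++ q2] by rewrite inE; case/andP: uq.
have w0Z : w0 \in [set t in q1 ++ q2] by rewrite inE.
have [lk'|lk'] := linked_step nc lk evu uZ w0Z; first exact: IHq.
by have [] := IHq u Y X pu uq lk'; [right | left].
Qed.

(** The special case of Menger's theorem for two disjoint paths, with the ends
    [z] and [b] prescribed by the path [q1] from [z] to [b]: of two disjoint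
    connections from [A] and [z] to [b] and [q2], one starts at [z] and one
    (possibly the same) ends at [b]. *)
Lemma linkage_along (nc : no_cut_vertex) z (A : {set T}) a0 q1 q2 :
  a0 \in A -> z \notin A -> path e z q1 -> uniq (z :: q1 ++ q2) ->
  (forall t, t \in q1 ++ q2 -> t \notin A) -> q2 != [::] ->
  let b := last z q1 in let Z := [set t in q2] in
  linked [set z] A b Z \/ linked A [set z] b Z.
Proof.
move=> a0A zA pz uz qA q2n /=.
have [w0 w0q2] : exists w0, w0 \in q2.
  by case: q2 q2n {uz qA} => // w0 q2 _; exists w0; rewrite inE eqxx.
(* Growing [A] while avoiding [z]; the empty set, rooted in the empty set,
   plays the part of the other connection and cannot grow. *)
have start : linked [set z] A z [set t in q1 ++ q2].
  have rp : rooted_pair set0 A (z |: [set t in q1 ++ q2]) set0 A.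
    split; [exact: rooted_refl | exact: rooted_refl | |].
      by rewrite disjoints_subset sub0set.
    rewrite set0U disjoint_sym disjoints_subset; apply/subsetP => t.
    by rewrite !inE => /orP[/eqP->|/qA].
  have a0D : a0 \in set0 :|: A by rewrite set0U.
  have w0F : w0 \in [set t in q1 ++ q2] by rewrite inE mem_cat w0q2 orbT.
  have w0z : w0 != z.
    by apply: contraTneq uz => <-; rewrite /= mem_cat w0q2 orbT.
  have [C1 [C1' [_ /subsetP sA [rC1 rC' dis disF] [d [w [dD wF edw]]]]]] :=
    rooted_pair_grow nc rp a0D w0F w0z.
  have C10 t : t \notin C1.
    by apply/negP => /(rC1.2)[u [p []]]; rewrite inE.
  move: dD; rewrite inE (negPf (C10 d)) /= => dC'.
  exists [set z], C1'; split; [split | by rewrite inE eqxx | by exists d, w].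
  - exact: rooted_refl.
  - exact: rC'.
  - have zF : z \in z |: [set t in q1 ++ q2] by rewrite !inE eqxx.
    by rewrite disjoints1; move: (disjointFl disF zF); rewrite inE => /norP[].
  - rewrite -setI_eq0 setIUl setU_eq0 !setI_eq0; apply/andP; split.
      by rewrite disjoints1 inE; case/andP: uz.
    apply: disjointWl (subsetUr C1 C1') _.
    by apply: disjointWr (subsetUr _ _) disF.
exact: linked_walk start.
Qed.

End Linkage.

(** * Long cycles from paths with ends of large degree *)

Section Kopylov.
Variables (T : finType) (e : rel T).
Hypotheses (e_sym : symmetric e) (e_irr : irreflexive e).

(** The part of the path up to [z] is meant to hold all neighbours of [x], and
    the part from [b] on those of [y].  Two disjoint connections between these
    two parts, one starting at [z] and one ending at [b], are closed up inside
    each part by a rerouted path that misses no neighbour of the corresponding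
    end. *)
Lemma cycle_through_uncrossed (nc : no_cut_vertex e) x z b y a q1 q2 :
  path e x a -> last x a = z -> e x z -> path e z q1 -> last z q1 = b ->
  path e b q2 -> last b q2 = y -> e b y -> uniq (x :: a ++ q1 ++ q2) ->
  exists L, [/\ ucycle e L, x \in L, {in a, forall w, e x w -> w \in L} &
                {in b :: q2, forall w, e y w -> w \in L}].
Proof.
move=> pa la exz pq1 lb pq2 ly eby uP.
have xz : x != z by apply: contraTneq exz => ->; rewrite e_irr.
have aE : x :: a = rcons (belast x a) z by rewrite lastI la.
pose A := [set t in belast x a].
have xA : x \in A.
  rewrite inE; case: a {pa uP aE A} la => [/= xzE|c a _].
    by rewrite xzE eqxx in xz.
  by rewrite inE eqxx.
have ua : uniq (x :: a) by move: uP; rewrite -cat_cons cat_uniq => /and3P[].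
have zA : z \notin A by move: ua; rewrite aE rcons_uniq inE => /andP[].
have xaE t : (t \in x :: a) = (t \in A) || (t == z).
  by rewrite aE mem_rcons !inE orbC.
have a_q t : t \in x :: a -> t \notin q1 ++ q2.
  move: uP; rewrite -cat_cons cat_uniq => /and3P[_ /hasPn dis _] ta.
  by apply/negP => /dis; rewrite ta.
have q2n : q2 != [::] by apply: contraTneq eby => q20; rewrite -ly q20 /= e_irr.
have uzq : uniq (z :: q1 ++ q2).
  rewrite /= a_q ?xaE ?eqxx ?orbT //.
  by move: uP; rewrite -cat_cons cat_uniq => /and3P[].
have qA t : t \in q1 ++ q2 -> t \notin A.
  by apply: contraTN => tA; apply: a_q; rewrite xaE tA.
have bq2 : b \notin q2.
  rewrite -lb; apply/negP => bq2; have := mem_last z q1.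
  rewrite inE => /orP[/eqP bz|bq1].
    by rewrite bz in bq2; move: uzq; rewrite /= mem_cat bq2 orbT.
  move: uzq; rewrite /= cat_uniq => /and4P[_ _ /hasPn/(_ _ bq2)].
  by rewrite /= bq1.
have upbq2 : upath e b y q2.
  rewrite /upath pq2 ly eqxx /= bq2.
  by move: uzq; rewrite /= cat_uniq => /and4P[].
(* A connection inside [x :: a] between the two starting points that contains
   [x] and all its neighbours; one of the starting points is [z]. *)
have [X [Y [XY_xa lk tA_ex]]] : exists X Y : {set T},
    [/\ forall t, t \in x :: a -> (t \in X) || (t \in Y),
        linked e X Y b [set t in q2] &
        forall u u', u \in X -> u' \in Y -> exists s,
          [/\ upath e u' u s, {subset u' :: s <= x :: a}, x \in u' :: s &
              {in a, forall w, e x w -> w \in u' :: s}]].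
  have upxz : upath e x z a by rewrite /upath pa la eqxx ua.
  case: (linkage_along nc xA zA pq1 uzq qA q2n); rewrite lb => lk.
    exists [set z], A; split=> // [t|u u']; first by rewrite xaE in_set1 orbC.
    by rewrite !inE => /eqP-> /(upath_reroute e_sym upxz exz).
  exists A, [set z]; split=> // [t|u u']; first by rewrite xaE in_set1.
  by rewrite !inE => /(upath_reroute_rev e_sym upxz exz)+ /eqP->.
have [C [C' [[[/subsetP XC rC] [/subsetP YC' rC'] dis disF] bC]]] := lk.
case=> [d [w [dC' + edw]]]; rewrite inE => wq2.
have [u [p1 [uX up1 p1C]]] := rC b bC.
have [u' [p2 [u'Y up2 p2C]]] := rC' d dC'.
have [tA [utA tAsub xtA covx]] := tA_ex u u' uX u'Y.
have Cq2 t : t \in q2 -> (t \notin C) && (t \notin C').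
  move=> tq2; rewrite -negb_or -in_setU (disjointFl disF) //.
  by rewrite inE.
(* Likewise at the other end, reading the path [b :: q2] from [y]. *)
have [tB [utB tBsub covy]] : exists s, [/\ upath e b w s, {subset s <= q2} &
     {in b :: q2, forall w, e y w -> w \in b :: s}].
  have [q2' uq2' eq2'] := upath_rev e_sym upbq2.
  have wB : w \in belast y q2'.
    have : w \in y :: q2' by rewrite eq2' inE wq2 orbT.
    rewrite lastI mem_rcons inE => /orP[/eqP wE|//].
    have /and3P[_ /eqP lq2' _] := uq2'.
    by move: wq2; rewrite wE lq2' (negPf bq2).
  have eyb : e y b by rewrite e_sym.
  have [s [us sub ys cov]] := upath_reroute_rev e_sym uq2' eyb wB.
  exists s; split=> // [t ts|v vbq eyv].
    have : t \in b :: q2 by rewrite -eq2'; apply: sub; rewrite inE ts orbT.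
    rewrite inE => /orP[/eqP tb|//].
    by have /and3P[_ _ /andP[]] := us; rewrite -tb ts.
  apply: cov => //; move: vbq; rewrite -eq2' inE.
  by case/orP => // /eqP vy; rewrite vy e_irr in eyv.
have up2w : upath e u' w (rcons p2 w).
  have /and3P[pp2 /eqP lp2 uu2] := up2.
  rewrite /upath rcons_path pp2 lp2 edw last_rcons eqxx.
  rewrite -rcons_cons rcons_uniq uu2 /= andbT inE.
  have /andP[_ wC'] := Cq2 w wq2; apply/norP; split.
    by apply: contraNneq wC' => ->; apply: YC'.
  by apply: contra wC' => /p2C; rewrite inE => /andP[].
have [p2r up2r p2rE] := upath_rev e_sym up2w.
have p2rP t : t \in p2r -> (t == u') || (t \in C') && (t \notin Y).
  move=> tp; have : t \in w :: p2r by rewrite inE tp orbT.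
  have tw : t != w.
    by have /and3P[_ _ /andP[wp _]] := up2r; apply: contraNneq wp => <-.
  rewrite p2rE inE mem_rcons inE (negPf tw) /= => /orP[->//|/p2C].
  by rewrite !inE andbC => ->; rewrite orbT.
have p1P t : t \in p1 -> (t \in C) && (t \notin X).
  by move/p1C; rewrite !inE andbC.
have tAP t : t \in tA -> (t \in x :: a) && (t != u').
  move=> ttA; rewrite tAsub ?inE ?ttA ?orbT //=.
  by have /and3P[_ _ /andP[uA _]] := utA; apply: contraNneq uA => <-.
have CC' t : t \in C -> t \in C' -> False.
  by move=> tC tC'; rewrite (disjointFr dis tC) in tC'.
have /and3P[ptA /eqP ltA utA'] := utA; have /and3P[pp1 /eqP lp1 up1'] := up1.
have /and3P[ptB /eqP ltB utB'] := utB; have /and3P[pp2 /eqP lp2 up2'] := up2r.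
(* The cycle runs from [u'] through the neighbours of [x] to [u], along the
   first connection to [b], through the neighbours of [y] to [w], and back along
   the second connection. *)
have lL : last u' (tA ++ p1 ++ tB ++ p2r) = u'.
  by rewrite !last_cat ltA lp1 ltB lp2.
pose L := tA ++ p1 ++ tB ++ p2r.
have Ln : L != [::].
  rewrite /L; case: (p2r) lp2 => [/= wu'|? ? _]; last first.
    by case: (tA); case: (p1); case: (tB).
  by have /andP[_] := Cq2 w wq2; rewrite wu' (YC' _ u'Y).
have u'L : u' \in L.
  by move: Ln lL; rewrite -/L; case: (L) => // c L' _ /= <-; apply: mem_last.
have tAL t : t \in u' :: tA -> t \in L.
  by rewrite inE /L !mem_cat => /orP[/eqP->|->//]; move: u'L; rewrite !mem_cat.
have bL : b \in L.
  have := mem_last u p1; rewrite lp1 inE => /orP[/eqP->|bp1]; last first.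
    by rewrite !mem_cat bp1 orbT.
  by apply: tAL; rewrite -ltA mem_last.
exists L; split; last 1 first.
- move=> v vb eyv; have := covy v vb eyv; rewrite inE => /orP[/eqP->//|vtB].
  by rewrite !mem_cat vtB !orbT.
- apply/andP; split.
    rewrite (cycle_path u'); have -> : last u' L = u' by [].
    by rewrite /L !cat_path ltA lp1 ltB ptA pp1 ptB pp2.
  apply: uniq_cat_disjoint; [by case/andP: utA' | | ]; last first.
    move=> t /tAP/andP[txa tu'].
    have /norP[tq1 tq2] : ~~ ((t \in q1) || (t \in q2)).
      by rewrite -mem_cat a_q.
    rewrite !mem_cat => /or3P[/p1P/andP[tC tX]|/tBsub|/p2rP].
    - by case/orP: (XY_xa t txa) => [|/YC']; [rewrite (negPf tX) | apply: CC'].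
    - by rewrite (negPf tq2).
    rewrite (negPf tu') => /andP[tC' tY].
    case/orP: (XY_xa t txa) => [/XC tC|]; last by rewrite (negPf tY).
    exact: CC' tC'.
  have p2rC' t : t \in p2r -> t \in C'.
    by case/p2rP/orP => [/eqP->|/andP[]//]; apply: YC'.
  apply: uniq_cat_disjoint; [by case/andP: up1' | | ]; last first.
    move=> t /p1P/andP[tC _]; rewrite mem_cat => /orP[/tBsub/Cq2|/p2rC'].
      by rewrite tC.
    exact: CC'.
  apply: uniq_cat_disjoint; [by case/andP: utB' | by case/andP: up2' |].
  by move=> t /tBsub/Cq2/andP[_ tC'] /p2rC'; rewrite (negPf tC').
- exact: tAL.
- by move=> v va exv; apply/tAL/covx.
Qed.

Definition long_cycle (c : nat) : Prop := exists2 L, ucycle e L & c <= size L.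

(** The positions of the vertices in [a] and those of the predecessors of the
    vertices in [b] are disjoint. *)
Lemma count_consecutive (a b : pred T) h s :
  path (fun u w => ~~ (a u && b w)) h s ->
  count a (belast h s) + count b s <= size s.
Proof.
elim: s h => //= w s IHs h /andP[nab /IHs]; move: nab.
case: (a h); case: (b w) => //= _; lia.
Qed.

Lemma count_last (a : pred T) h s :
  count a (h :: s) = count a (belast h s) + a (last h s).
Proof. by rewrite lastI -cats1 count_cat /= addn0. Qed.

(** From [x] to a neighbour of [y], over to [y], and back to a neighbour of
    [x]. *)
Lemma crossing_cycle x s1 v s2 (y := last v s2) :
  path e x s1 -> path e v s2 -> uniq (x :: s1 ++ v :: s2) ->
  e (last x s1) y -> e x v -> ucycle e ((x :: s1) ++ rev (v :: s2)).
Proof.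
move=> p1 p2 us ey ex; apply/andP; split; last first.
  have sE : perm_eq (x :: s1 ++ v :: s2) ((x :: s1) ++ rev (v :: s2)).
    by rewrite -cat_cons perm_cat2l perm_sym perm_rev.
  by rewrite -(perm_uniq sE).
rewrite /= rcons_cat cat_path p1 lastI rev_rcons /= ey rcons_path path_rev //=.
case: s2 {p2 us ey} @y => [|c s2] /=; first by rewrite e_sym.
by rewrite rev_cons last_rcons e_sym.
Qed.

(** Choose [mid] as short as possible: it then contains no neighbour of [x] or
    [y], so the cycle that avoids it contains all of them.  If no neighbour of
    [y] is followed at once by a neighbour of [x], each of the two remaining
    segments has at least as many vertices as incidences with [x] and [y]. *)
Lemma crossing_long_cycle c x p (y := last x p) s1 mid v s2 :
  path e x p -> uniq (x :: p) -> c <= size (x :: p) ->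
  c <= count (e x) (x :: p) + count (e y) (x :: p) ->
  p = s1 ++ mid ++ v :: s2 -> e (last x s1) y -> e x v -> long_cycle c.
Proof.
move=> pp up cp cd; pose r u w := ~~ (e y u && e x w).
have crossE t1 t v' t2 : p = t1 ++ t ++ v' :: t2 -> e (last x t1) y -> e x v' ->
    ucycle e ((x :: t1) ++ rev (v' :: t2)).
  move=> Ep ey ex; have yE : y = last v' t2 by rewrite /y Ep !last_cat.
  rewrite yE in ey; apply: crossing_cycle => //.
  - by move: pp; rewrite Ep cat_path => /andP[].
  - by move: pp; rewrite Ep !cat_path /= => /and4P[].
  - apply: subseq_uniq up; rewrite Ep -!cat_cons; apply: cat_subseq => //.
    exact: suffix_subseq.
have [rp|/not_path[t1 [u [w [t2 [Ep]]]]]] := boolP (path r x p); last first.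
  rewrite negbK => /andP[eyu exw] _ _ _.
  have [t [Ep' lt]] : exists t, p = t ++ w :: t2 /\ last x t = u.
    case: t1 Ep => [[-> ->]|a t1 [_ ->]]; first by exists [::].
    by exists (rcons t1 u); rewrite cat_rcons last_rcons.
  exists ((x :: t) ++ rev (w :: t2)).
    by apply: (crossE t [::]) => //; rewrite lt e_sym.
  by rewrite size_cat size_rev; move: cp; rewrite Ep' /= size_cat /=.
have [m] := ubnP (size mid).
elim: m s1 mid v s2 => // m IHm s1 mid v s2 sm Ep ey ex.
have [/hasP[w wmid exw]|nx] := boolP (has (e x) mid).
  case/splitPr: wmid sm Ep => m1 m2 sm Ep.
  apply: (IHm s1 m1 w (m2 ++ v :: s2)) => //; last by rewrite Ep -catA.
  by move: sm; rewrite size_cat /=; lia.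
have [/hasP[w wmid eyw]|ny] := boolP (has (e y) mid).
  case/splitPr: wmid sm Ep => m1 m2 sm Ep.
  apply: (IHm (s1 ++ rcons m1 w) m2 v s2) => //.
  - by move: sm; rewrite size_cat /=; lia.
  - by rewrite Ep -!catA cat_rcons.
  - by rewrite last_cat last_rcons e_sym.
exists ((x :: s1) ++ rev (v :: s2)); first exact: (crossE s1 mid).
apply: leq_trans cd _; rewrite size_cat size_rev Ep -!cat_cons !count_cat.
have yE : y = last v s2 by rewrite /y Ep !last_cat.
move: nx ny; rewrite !has_count -!leqNgt !leqn0 => /eqP-> /eqP->.
move: rp; rewrite Ep !cat_path /=.
case/and4P=> [/count_consecutive r1 _ _ /count_consecutive r2].
have := count_last (e y) x s1; have := count_last (e y) v s2.
rewrite -yE e_irr /= ex e_irr; move: r1 r2; case: (e y (last x s1)); lia.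
Qed.

(** Let [z] be the last neighbour of [x] on the path.  Either [y] has a
    neighbour before [z], which is the crossing case, or all its neighbours come
    from [z] on.  In the second case [x] and [y] share at most the neighbour
    [z], and counting [x] itself makes up for it. *)
Lemma kopylov_long_cycle (nc : no_cut_vertex e) c x p (y := last x p) :
  path e x p -> uniq (x :: p) -> 1 < c -> c <= size (x :: p) ->
  c <= count (e x) (x :: p) + count (e y) (x :: p) -> long_cycle c.
Proof.
move=> pp up c1 cp cd.
have hx : has (e x) p.
  by case: (p) pp cp => /= [|w s /andP[->]] //; lia.
have [a [z [q [Ep exz nq]]]] := split_last hx.
have [/hasP[t ta eyt]|ny] := boolP (has (e y) (x :: a)).
  have [s1 [mid [Ea lt]]] : exists s1 mid, a = s1 ++ mid /\ last x s1 = t.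
    move: ta; rewrite inE => /orP[/eqP->|]; first by exists [::], a.
    case/splitPr=> s1 s2; exists (rcons s1 t), s2.
    by rewrite cat_rcons last_rcons.
  have Ep' : p = s1 ++ mid ++ z :: q by rewrite Ep Ea catA.
  by apply: (crossing_long_cycle pp up cp cd Ep') => //; rewrite lt e_sym.
have yE : y = last z q by rewrite /y Ep last_cat.
have hy : has (e y) (z :: q).
  case/lastP: q Ep yE {nq} => [|q w] Ep yE.
    by move: ny; rewrite yE /= e_sym exz.
  move: pp; rewrite Ep -cat_rcons -rcons_cat rcons_path => /andP[_].
  rewrite last_cat last_rcons -[w](last_rcons z q w) -yE e_sym => ely.
  apply/hasP; exists (last z q) => //.
  by rewrite -rcons_cons mem_rcons inE mem_last orbT.
have [q1 [q2 [Eq eby nb]]] : exists q1 q2, [/\ q = q1 ++ q2, e (last z q1) y &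
    {in z :: q, forall t, e y t -> t \in last z q1 :: q2}].
  have [b [s1 [s2 [E eyb nb]]]] : exists b s1 s2,
      [/\ z :: q = rcons s1 b ++ s2, e y b & ~~ has (e y) s1].
    by case/split_find: hy => b s1 s2; exists b, s1, s2.
  have nb' : {in z :: q, forall t, e y t -> t \in b :: s2}.
    move=> t; rewrite E cat_rcons mem_cat => /orP[ts1 eyt|//].
    by case/hasP: nb; exists t.
  case: s1 E {nb} => [[zb qs]|w s1 [_ qs]].
    by exists [::], s2; rewrite /= zb e_sym -qs in nb' *.
  by exists (rcons s1 b), s2; rewrite last_rcons e_sym.
have pp' := pp; rewrite Ep Eq -cat_rcons !cat_path last_rcons in pp'.
case/and3P: pp' => pa pq1 pq2.
have ly : last (last z q1) q2 = y by rewrite yE Eq last_cat.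
have up' := up; rewrite Ep Eq -cat_rcons in up'.
have [L [cL xL covx covy]] := cycle_through_uncrossed nc pa
  (last_rcons _ _ _) exz pq1 erefl pq2 ly eby up'.
exists L => //; apply: leq_trans cd _.
rewrite -!size_filter.
set sx := filter _ _; set sy := filter _ _.
have zsx : z \in sx by rewrite mem_filter exz Ep inE mem_cat inE eqxx !orbT.
have usx : uniq sx by apply: filter_uniq.
have usy : uniq sy by apply: filter_uniq.
have sxa t : t \in sx -> t \in rcons a z.
  rewrite mem_filter inE => /andP[ext]; case/orP => [/eqP tx|].
    by rewrite tx e_irr in ext.
  rewrite Ep -cat_rcons mem_cat => /orP[//|tq].
  by case/hasP: nq; exists t.
have nya t : t \in x :: a -> t \notin sy.
  move=> ta; rewrite mem_filter; apply/negP => /andP[eyt _].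
  by case/hasP: ny; exists t.
have syb t : t \in sy -> t \in L.
  move=> tsy; have := tsy; rewrite mem_filter => /andP[eyt tP].
  apply: covy => //; apply: nb => //; move: tP.
  rewrite Ep -cat_cons mem_cat => /orP[ta|//].
  by rewrite (negPf (nya t ta)) in tsy.
(* [x] is counted in place of the possibly common neighbour [z]. *)
have : size (x :: rem z sx ++ sy) <= size L.
  apply: uniq_leq_size.
    rewrite cons_uniq mem_cat negb_or (nya x) ?inE ?eqxx // andbT.
    apply/andP; split.
      by apply/negP => /mem_rem; rewrite mem_filter e_irr.
    apply: uniq_cat_disjoint => //; first exact: rem_uniq.
    move=> t; rewrite mem_rem_uniq // !inE => /andP[tz /sxa].
    rewrite mem_rcons inE (negPf tz) /= => ta.
    by apply/negP/nya; rewrite inE ta orbT.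
  move=> t; rewrite inE mem_cat => /or3P[/eqP->//|/mem_rem tsx|/syb//].
  by apply: covx; [exact: sxa | move: tsx; rewrite mem_filter => /andP[]].
by rewrite /= size_cat size_rem // -addSn prednK //; case: (sx) zsx.
Qed.

End Kopylov.

(** * Edge-maximal graphs *)

Section Saturation.
Variables (T : finType) (e : rel T).
Hypotheses (e_sym : symmetric e) (e_irr : irreflexive e).

Definition add_edge (x y : T) : rel T :=
  fun u w => e u w || ((u == x) && (w == y) || (u == y) && (w == x)).

Lemma add_edge_sym x y : symmetric (add_edge x y).
Proof.
move=> u w; rewrite /add_edge e_sym orbC [in RHS]orbC.
by rewrite ![(w == _) && _]andbC [in RHS](orbC (_ && _)).
Qed.

Lemma add_edge_irr x y : x != y -> irreflexive (add_edge x y).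
Proof.
move=> xy u; rewrite /add_edge e_irr /=; case: eqP => [->|_] //=.
  by rewrite (negPf xy).
by rewrite andbF.
Qed.

(** A long cycle that is not one of [e] passes through the new edge, whose
    removal leaves a long path. *)
Lemma add_edge_long_cycle x y c : 2 < c ->
  long_cycle (add_edge x y) c ->
  long_cycle e c \/ exists2 p, upath e x y p & c <= size (x :: p).
Proof.
move=> c2 [L /andP[cL uL] szL].
have [eL|nL] := boolP (all (fun u => e (prev L u) u) L).
  left; exists L => //; apply/andP; split => //.
  by apply: cycle_from_prev => //; apply/allP.
right; case/allPn: nL => u uIn nuu.
have [i L' EL] := rot_to uIn.
have cr : cycle (add_edge x y) (u :: L') by rewrite -EL rot_cycle.
have ur : uniq (u :: L') by rewrite -EL rot_uniq.
have sr : size (u :: L') = size L by rewrite -EL size_rot.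
have prevE : prev L u = last u L'.
  rewrite -(prev_rot i uL) EL /=; have /andP[uL' _] := ur.
  suff prevE w : u \notin L' -> prev_at u u w L' = last w L' by apply: prevE.
  elim: L' w {EL cr ur sr uL'} => [|w' L' IH] w /=; first by rewrite eqxx.
  by rewrite inE negb_or => /andP[/negPf-> /IH].
rewrite {}prevE in nuu; rewrite -{}sr in szL.
move: cr; rewrite /= rcons_path => /andP[pL /orP[elu|lu]].
  by rewrite elu in nuu.
have lu' : (last u L' = x /\ u = y) \/ (last u L' = y /\ u = x).
  by case/orP: lu => /andP[/eqP-> /eqP->]; [left|right].
have {}pL : path e u L'.
  apply/negPn/negP => /not_path[s1 [v [w [s2 [Es nvw]]]]].
  have : add_edge x y v w.
    case: s1 Es => [[uE LE]|a s1 [_ LE]]; move: pL; rewrite LE /=.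
      by case/andP; rewrite uE.
    by rewrite cat_path /= => /and4P[].
  have /andP[uL' uqL'] := ur.
  have wu : w != u.
    have wL' : w \in L'.
      case: s1 Es => [[_ ->]|a s1 [_ ->]]; first by rewrite inE eqxx.
      by rewrite mem_cat !inE eqxx !orbT.
    by apply: contraNneq uL' => <-.
  case/orP => [evw|vw]; first by rewrite evw in nvw.
  have {vw} [vE wE] : v = u /\ w = last u L'.
    case: lu' vw => -[-> uE] /orP[] /andP[/eqP vE /eqP wE];
      rewrite ?vE ?wE ?uE //; by rewrite wE uE eqxx in wu.
  (* The new edge joins the two ends of a duplicate-free list, so it can only
     be traversed inside the list if the list has length 2. *)
  case: s1 Es => [[_ LE]|a s1 [uE LE]]; last first.
    by case/negP: uL'; rewrite LE vE mem_cat inE eqxx orbT.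
  case: s2 LE => [|b s2] LE.
    by move: szL; rewrite LE; case: (c) c2 => [|[|[|]]].
  move: uqL' wE; rewrite LE /= => /andP[wn _] wE.
  by rewrite wE mem_last in wn.
have uLp : upath e u (last u L') L' by rewrite /upath pL eqxx.
case: lu' => -[lE uE]; rewrite lE uE in uLp; last by exists L'.
have [p up pE] := upath_rev e_sym uLp; exists p => //.
have sub : {subset u :: L' <= x :: p} by move=> t; rewrite pE uE.
exact: leq_trans szL (uniq_leq_size ur sub).
Qed.

Definition saturated (c : nat) : Prop := forall x y, x != y -> ~~ e x y ->
  exists2 p, upath e x y p & c <= size (x :: p).

Lemma degree_in_le_count (U : {set T}) x s :
  (forall w, w \in U -> e x w -> w \in s) -> degree_in e U x <= count (e x) s.
Proof.
move=> Us; rewrite /degree_in cardE -size_filter; apply: uniq_leq_size.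
  exact: enum_uniq.
by move=> w; rewrite mem_enum inE mem_filter => /andP[wU exw]; rewrite exw Us.
Qed.

(** Take a longest path between a nonadjacent pair from [U] and [H].  A
    neighbour of an end, in the set of that end and off the path, would give
    either a longer such path or a long cycle; hence all these neighbours lie on
    the path and Kopylov's lemma applies.  The induction on [#|T| - size p] replaces the
    choice of a longest path. *)
Lemma saturated_adjacent c d1 d2 (U H : {set T}) :
  no_cut_vertex e -> 1 < c -> ~ long_cycle e c -> saturated c ->
  (forall x, x \in U -> d1 <= degree_in e U x) ->
  (forall y, y \in H -> d2 <= degree_in e H y) -> c <= d1 + d2 ->
  {in U & H, forall x y, x != y -> e x y}.
Proof.
move=> nc c1 nlong sat dU dH cd x y xU yH xy; apply/negPn/negP => nxy.
have [p up cp] := sat x y xy nxy.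
have [m] := ubnP (#|T| - size p).
elim: m x y p xU yH {xy} nxy up cp => // m IHm x y p xU yH nxy up cp pm.
have /and3P[pp /eqP lp upp] := up.
have longer (q : seq T) h :
    uniq (h :: q) -> size q = (size p).+1 -> #|T| - size q < m.
  move=> hq sq; have : size (h :: q) <= #|T|.
    by rewrite -(card_uniqP hq) max_card.
  by move: pm; rewrite /= sq; lia.
have [/forall_inP nx|] :=
  boolP [forall x' in U, e x x' ==> (x' \in x :: p)]; last first.
  case/forall_inPn => x' x'U; rewrite negb_imply => /andP[exx' x'p].
  have ux' : uniq (x' :: x :: p) by rewrite cons_uniq x'p.
  have px' : path e x' (x :: p) by rewrite /= e_sym exx'.
  have [ex'y|nx'y] := boolP (e x' y).
    apply: nlong; exists (x' :: x :: p); last exact: leq_trans cp _.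
    by rewrite /ucycle ux' andbT (cycle_path x) /= lp e_sym ex'y e_sym exx'.
  apply: (IHm x' y (x :: p)) => //; first by rewrite /upath px' ux' /= lp eqxx.
    by rewrite /= ltnW.
  exact: longer ux' _.
have [/forall_inP ny|] :=
  boolP [forall y' in H, e y y' ==> (y' \in x :: p)]; last first.
  case/forall_inPn => y' y'H; rewrite negb_imply => /andP[eyy' y'p].
  have uy' : uniq (x :: rcons p y') by rewrite -rcons_cons rcons_uniq y'p.
  have py' : path e x (rcons p y') by rewrite rcons_path pp lp.
  have [exy'|nxy'] := boolP (e x y').
    apply: nlong; exists (x :: rcons p y'); last by rewrite /= size_rcons ltnW.
    by rewrite /ucycle uy' andbT (cycle_path x) /= last_rcons py' e_sym exy'.
  apply: (IHm x y' (rcons p y')) => //.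
  - by rewrite /upath py' uy' last_rcons eqxx.
  - by rewrite /= size_rcons ltnW.
  - by apply: longer uy' _; rewrite size_rcons.
apply: nlong; apply: (kopylov_long_cycle e_sym e_irr nc pp upp) => //.
apply: leq_trans cd _; rewrite lp; apply: leq_add.
  apply: leq_trans (dU x xU) (degree_in_le_count _) => w wU exw.
  by apply: (implyP (nx w wU)).
apply: leq_trans (dH y yH) (degree_in_le_count _) => w wH eyw.
by apply: (implyP (ny w wH)).
Qed.

Lemma complete_cycle L : uniq L -> 1 < size L ->
  {in L &, forall x y, x != y -> e x y} -> cycle e L.
Proof.
case: L => // h s uL sz adj; rewrite (cycle_path h) /=.
have hs : last h s != h.
  case: s uL sz {adj} => // a s /= /andP[hn _] _.
  by apply: contraNneq hn => <-; apply: mem_last.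
rewrite adj ?mem_last ?inE ?eqxx //=.
have : sorted [rel x y : T | x != y] (h :: s).
  by apply: pairwise_sorted; rewrite -uniq_pairwise.
by apply: (sub_in_path (P := mem (h :: s))) => //; apply/allP.
Qed.

Lemma saturated_bound n c s k (t := (c.-1)./2) :
  #|T| = n -> 5 <= c <= n -> 2 <= s -> no_cut_vertex e ->
  ~ long_cycle e c -> saturated c ->
  (forall x, k <= degree_in e [set: T] x) ->
  num_cliques e s <= maxn (f_s s n k c) (f_s s n t c).
Proof.
move=> cardT /andP[c5 cn] s2 nc nlong sat degk.
have s0 : 0 < s by apply: ltnW.
have c1 : 1 < c by lia.
have ct : c <= t.+1 + t.+1 by rewrite /t; lia.
pose H := core e t; pose r := #|H|.
rewrite num_cliquesE -cardsT in cardT *.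
have [H0|[h hH]] := set_0Vmem H.
  rewrite leq_max; apply/orP; right; rewrite /f_s -cardT.
  by apply: num_cliques_in_core; rewrite ?subsetT // -/H H0 cards0.
(* The core is complete, being completely joined to itself. *)
have complH : {in H &, forall x y, x != y -> e x y}.
  by apply: (saturated_adjacent nc c1 nlong sat) ct => x; apply: core_degree.
(* [r - 1] rather than [r], as [x] may itself belong to the core. *)
have joinH x (S : {set T}) : H \subset S -> {in H, forall y, x != y -> e x y} ->
    r.-1 <= degree_in e S x.
  move=> /subsetP HS adj; rewrite -ltnS.
  apply: leq_trans (_ : #|H :\ x|.+1 <= _).
    by rewrite /r (cardsD1 x H); case: (x \in H); lia.
  apply/subset_leq_card/subsetP => y; rewrite !inE => /andP[yx yH].
  by rewrite HS // adj // eq_sym.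
have rt : t.+2 <= r.
  have : degree_in e H h <= #|H :\ h|.
    apply/subset_leq_card/subsetP => y; rewrite !inE => /andP[-> ehy].
    by rewrite andbT; apply: contraTneq ehy => ->; rewrite e_irr.
  have := core_degree hH; rewrite -/H /r (cardsD1 h H) hH; lia.
(* A vertex joined to the whole core has at least [t + 1] neighbours in it, so
   adding it keeps the defining property of the core. *)
have fullH x : {in H, forall y, x != y -> e x y} -> x \in H.
  move=> adj; apply: (subsetP (sub_core (_ : forall z, z \in x |: H -> _))).
    move=> z /setU1P[->|zH].
      by apply: leq_trans (joinH x _ (subsetUr _ _) adj); lia.
    by apply: leq_trans (core_degree zH) (degree_in_subset _ _ (subsetUr _ _)).
  exact: setU11.
have degH y : y \in H -> r.-1 <= degree_in e H y.
  by move=> yH; apply: joinH => // z zH; apply: complH.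
(* Otherwise the whole graph is complete, of order at least [c]. *)
have kr : k + r <= c.
  rewrite leqNgt; apply/negP => ckr.
  have HT x : x \in H.
    apply: fullH => y yH.
    apply: (saturated_adjacent nc c1 nlong sat _ degH) yH => //.
    by rewrite -ltnS -addnS (ltn_predK rt).
  have sT : c <= size (enum T) by rewrite -cardE -cardsT cardT.
  apply: nlong; exists (enum T) => //; rewrite /ucycle enum_uniq andbT.
  apply: complete_cycle; [exact: enum_uniq | exact: leq_trans sT |].
  by move=> x y _ _; apply: complH.
have coreH : core e (c - r) \subset H.
  apply/subsetP => x xc; apply: fullH => y yH.
  apply: (saturated_adjacent nc c1 nlong sat _ degH) xc yH => [z|].
    exact: core_degree.
  lia.
have le_fs : num_cliques_in e [set: T] s <= f_s s n (c - r) c.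
  have -> : f_s s n (c - r) c = 'C(r, s) + 'C(c - r, s.-1) * (#|[set: T]| - r).
    by rewrite /f_s cardT subKn //; lia.
  by apply: num_cliques_in_core; rewrite ?subsetT // subset_leq_card.
apply: leq_trans le_fs _.
apply: (convex_le_max (f := fun i => f_s s n i c)); last lia.
by move=> i _ it; apply: f_s_convex => //; lia.
Qed.

End Saturation.

(** * The theorem *)

Lemma long_cycleP (T : finType) (e : rel T) c : 2 < c ->
  reflect (long_cycle e c) (c <= circumference e).
Proof.
move=> c2; apply: (iffP idP) => [|[L /andP[cL uL] szL]].
  have [/existsP[m /andP[/andP[_ /existsP[p cp]] cm]] _|/existsPn none] :=
    boolP [exists m : 'I_#|T|.+1, has_cycle e m && (c <= m)].
    by exists p; rewrite ?size_tuple.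
  rewrite leqNgt => /negP[]; rewrite /circumference.
  rewrite -(ltn_predK c2) ltnS; apply/bigmax_leqP => m cm; have := none m.
  by rewrite cm -ltnNge -{1}(ltn_predK c2) ltnS.
have sT : size L < #|T|.+1 by rewrite ltnS -(card_uniqP uL) max_card.
apply: leq_trans (szL) _.
apply: (leq_bigmax_cond (F := fun m : 'I_#|T|.+1 => val m) (Ordinal sT)).
rewrite /has_cycle /= (leq_trans c2 szL) /=.
by apply/existsP; exists (in_tuple L); apply/andP.
Qed.

Lemma vertex_connected_no_cut_vertex (T : finType) (e : rel T) :
  vertex_connected e 2 -> no_cut_vertex e.
Proof.
case/andP=> _ /forallP conn D u d0 w0 d0D uD w0D w0u.
have [/exists_inP[d dD /existsP[w /and3P[wD wu edw]]]|noedge] :=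
  boolP [exists d in D, exists w, [&& w \notin D, w != u & e d w]].
  by exists d, w.
have := conn [set u]; rewrite cards1 /= => /forall_inP/(_ d0).
have d0u : d0 \in ~: [set u] by rewrite !inE; apply: contraNneq uD => <-.
move/(_ d0u)/forall_inP/(_ w0); rewrite !inE w0u => /(_ isT) /connectP[p].
move=> pp lp; case/negP: w0D; rewrite {}lp.
elim: p d0 d0D {d0u} pp => //= w p IHp d dD /andP[/and3P[_ wu edw] pp].
apply: IHp pp; apply: contraR noedge => wD.
apply/exists_inP; exists d => //; apply/existsP; exists w.
by rewrite !inE in wu; rewrite wD wu.
Qed.

Lemma min_degree_le (T : finType) (e : rel T) x :
  min_degree e <= degree_in e [set: T] x.
Proof.
have -> : degree_in e [set: T] x = degree e x.
  by congr #|pred_of_set _|; apply/setP => y; rewrite !inE.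
rewrite /min_degree; have := mem_index_enum x.
elim: (index_enum T) => // a r IHr; rewrite inE big_cons geq_min.
by case/orP=> [/eqP->|/IHr->]; rewrite ?leqnn ?orbT.
Qed.

(** Induction on the number of nonadjacent pairs: an edge is added as long as
    this does not create a cycle of length at least [c]. *)
Lemma clique_bound (T : finType) (e : rel T) n c s k :
  symmetric e -> irreflexive e -> #|T| = n -> 5 <= c <= n -> 2 <= s ->
  no_cut_vertex e -> ~ long_cycle e c ->
  (forall x, k <= degree_in e [set: T] x) ->
  num_cliques e s <= maxn (f_s s n k c) (f_s s n (c.-1)./2 c).
Proof.
move=> + + cardT cn s2; have c2 : 2 < c by lia.
have [m] := ubnP #|[set q : T * T | ~~ e q.1 q.2]|.
elim: m e => // m IHm e em e_sym e_irr nc nlong degk.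
have [|/existsPn sat] := boolP [exists x, exists y,
  [&& x != y, ~~ e x y & ~~ (c <= circumference (add_edge e x y))]].
  case/existsP=> x /existsP[y /and3P[xy nxy /(long_cycleP _ c2) nlong']].
  have sube u w : e u w -> add_edge e x y u w by rewrite /add_edge => ->.
  apply: leq_trans (num_cliques_homo s sube) _; apply: IHm => //.
  - rewrite -ltnS; apply: leq_trans em; rewrite ltnS.
    apply/proper_card/properP; split.
      by apply/subsetP => q; rewrite !inE; apply/contra/sube.
    by exists (x, y); rewrite !inE // negbK /add_edge !eqxx orbT.
  - exact: add_edge_sym.
  - exact: add_edge_irr.
  - move=> D u d0 w0 d0D uD w0D w0u.
    have [d [w [? ? ? /sube ?]]] := nc D u d0 w0 d0D uD w0D w0u.
    by exists d, w.
  - move=> z; apply: leq_trans (degk z) _; apply/subset_leq_card/subsetP => w.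
    by rewrite !inE /= => /sube.
apply: saturated_bound => // x y xy nxy.
have /existsPn/(_ y) := sat x; rewrite xy nxy /= negbK => /(long_cycleP _ c2).
by case/(add_edge_long_cycle e_sym c2).
Qed.

Theorem theorem3p3 (n c s k : nat) (T : finType) (e : rel T)
  (c_ge5 : 5 <= c) (n_gec : c <= n) (s_ge2 : 2 <= s) (k_ge2 : 2 <= k)
  (G_simple : simple_graph e) (G_order : #|T| = n)
  (G_2conn : vertex_connected e 2)
  (G_circ : circumference e < c)
  (G_mindeg : k <= min_degree e) :
  num_cliques e s <= maxn (f_s s n k c) (f_s s n (c.-1)./2 c).
Proof.
have [e_sym e_irr] := G_simple; have c2 : 2 < c by apply: leq_trans c_ge5.
apply: clique_bound => //; first by rewrite c_ge5.
- exact: vertex_connected_no_cut_vertex.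
- by move/(long_cycleP _ c2); rewrite leqNgt G_circ.
- by move=> x; apply: leq_trans G_mindeg (min_degree_le e x).
Qed.
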